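(* Let $a,b\in R^{WD\dagger}$, let $a^{WD}$, $b^{WD}$ be WD inverses of $a$ and $b$, and let $a^{WD\dagger}=a^{WD}aa^\dagger$, $b^{WD\dagger}=b^{WD}bb^\dagger$ be the associated WDMP inverses. If $ab=ba=0$, $a^*b=ab^*=0$, $ab^{WD}=b^{WD}a=0$ and $a^{WD}b=ba^{WD}=0$, then $a+b$ is WDMP invertible and $a^{WD\dagger}+b^{WD\dagger}$ is a WDMP inverse of $a+b$, i.e. $(a+b)^{WD\dagger}=a^{WD\dagger}+b^{WD\dagger}$.
   Context: $R$ is a proper unital ring with involution: an associative ring with $1$ and a map $*:R\to R$ with $(a+b)^*=a^*+b^*$, $(ab)^*=b^*a^*$, $(a^* )^*=a$, such that $a^*a=0$ implies $a=0$. Moore-Penrose inverse: $a^\dagger$ is the unique $x$ (if it exists) with $axa=a$, $xax=x$, $(ax)^*=ax$, $(xa)^*=xa$; $R^\dagger$ is the set of Moore-Penrose invertible elements. Weak Drazin (WD) inverse: $a\in R$ is WD invertible if there are $x\in R$ and a positive integer $k$ with $axa=a$, $a^{k+1}x=a^k$, $xa^{k+1}=a^k$. The least positive integer $k$ for which such an $x$ exists is the weak Drazin index $\mathrm{ind}(a)$; any $x$ satisfying the three equations with $k=\mathrm{ind}(a)$ is a WD inverse of $a$ (not unique in general), denoted $a^{WD}$. $R^{WD}$ is the set of WD invertible elements. WDMP inverse: for $a\in R^{WD}\cap R^\dagger$, an element $y\in R$ is a WDMP inverse of $a$ if, for some WD inverse $a^{WD}$ of $a$ and $k=\mathrm{ind}(a)$,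 $yay=y$, $ay=aa^\dagger$, $ya^k=a^{WD}a^k$. $R^{WD\dagger}$ is the set of elements of $R^{WD}\cap R^\dagger$ having a WDMP inverse. For each WD inverse $a^{WD}$, the element $a^{WD}aa^\dagger$ is a WDMP inverse of $a$. *)

(* Defs.v *)
From mathcomp Require Import all_boot all_order all_algebra.

Set Implicit Arguments.
Unset Strict Implicit.
Unset Printing Implicit Defensive.

Import GRing.Theory.
Local Open Scope ring_scope.

(* [pzRingType] is the class of associative unital rings, with 0 = 1 allowed. *)

Record ring_involution (R : pzRingType) (star : R -> R) : Prop :=
  RingInvolution {
    starD : forall a b, star (a + b) = star a + star b;
    starM : forall a b, star (a * b) = star b * star a;
    starK : forall a, star (star a) = a
  }.

Definition proper_involution (R : pzRingType) (star : R -> R) : Prop :=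
  ring_involution star /\ forall a, star a * a = 0 -> a = 0.

(* Inverses are relations rather than functions: the WD and WDMP inverses are
   not unique, and the Moore-Penrose inverse is partial. *)

Definition MP_inverse (R : pzRingType) (star : R -> R) (a x : R) : Prop :=
  [/\ a * x * a = a, x * a * x = x, star (a * x) = a * x
    & star (x * a) = x * a].

Definition MP_invertible (R : pzRingType) (star : R -> R) (a : R) : Prop :=
  exists x, MP_inverse star a x.

Definition WD_equations (R : pzRingType) (a : R) (k : nat) (x : R) : Prop :=
  [/\ a * x * a = a, a ^+ k.+1 * x = a ^+ k & x * a ^+ k.+1 = a ^+ k].

Definition WD_invertible (R : pzRingType) (a : R) : Prop :=
  exists (k : nat) (x : R), (0 < k)%N /\ WD_equations a k x.

Definition WD_index (R : pzRingType) (a : R) (k : nat) : Prop :=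
  [/\ (0 < k)%N, exists x, WD_equations a k x
    & forall j x, (0 < j)%N -> WD_equations a j x -> (k <= j)%N].

Definition WD_inverse (R : pzRingType) (a x : R) : Prop :=
  exists k, WD_index a k /\ WD_equations a k x.

Definition WDMP_inverse (R : pzRingType) (star : R -> R) (a y : R) : Prop :=
  exists aWD adag k,
    [/\ WD_inverse a aWD, MP_inverse star a adag & WD_index a k] /\
    [/\ y * a * y = y, a * y = a * adag & y * a ^+ k = aWD * a ^+ k].

Definition WDMP_invertible (R : pzRingType) (star : R -> R) (a : R) : Prop :=
  [/\ WD_invertible a, MP_invertible star a
    & exists y, WDMP_inverse star a y].

(* Main.v *)
(* The relations make the products of [a], [aWD], [adag] with [b], [bWD], [bdag]
   that matter vanish, so the equations for [a + b] split into those for [a] and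
   for [b].  The index is the delicate point: any solution [z] of the WD equations
   of [a + b] at [j] also solves those of [a] and of [b] at [j], because the
   Moore-Penrose projections of [a] annihilate [b] and vice versa.  Hence
   ind(a + b) = max(ind a, ind b). *)

Require Import Defs.
From mathcomp Require Import all_boot all_order all_algebra.

Set Implicit Arguments.
Unset Strict Implicit.
Unset Printing Implicit Defensive.

Import GRing.Theory.
Local Open Scope ring_scope.

Section WDMPSum.

Variables (R : pzRingType) (star : R -> R).
Implicit Types (a b x y z : R) (i j k : nat).

Lemma ring_involution0 : ring_involution star -> star 0 = 0.
Proof.
by move=> Hs; apply: (addrI (star 0)); rewrite -(starD Hs) !addr0.
Qed.

Lemma ring_involution_mul_eq0 a b :
  ring_involution star -> a * b = 0 -> star b * star a = 0.
Proof. by move=> Hs ab0; rewrite -(starM Hs) ab0 ring_involution0. Qed.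

(** Self-adjointness of [a * x] gives [x = x * star x * star a], so whatever [star a] kills on its
    right, [x] kills too. *)
Lemma MP_inverse_mul_eq0 a x b : ring_involution star ->
  MP_inverse star a x -> star a * b = 0 -> x * b = 0.
Proof.
move=> Hs [_ xax ax _] ab0.
by rewrite -xax -(mulrA x a x) -ax (starM Hs) -!mulrA ab0 !mulr0.
Qed.

(** Mirror image: [x = star a * star x * x] because [x * a] is self-adjoint. *)
Lemma mul_MP_inverse_eq0 a x b : ring_involution star ->
  MP_inverse star a x -> b * star a = 0 -> b * x = 0.
Proof.
move=> Hs [_ xax _ xa] ba0.
by rewrite -xax -xa (starM Hs) !mulrA ba0 !mul0r.
Qed.

Lemma MP_inverseD a b x y :
  MP_inverse star a x -> MP_inverse star b y -> ring_involution star ->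
  a * y = 0 -> b * x = 0 -> x * b = 0 -> y * a = 0 ->
  MP_inverse star (a + b) (x + y).
Proof.
move=> [axa xax ax xa] [byb yby By yb] Hs ay bx xb ya.
have E1 : (a + b) * (x + y) = a * x + b * y.
  by rewrite mulrDl !mulrDr ay bx addr0 add0r.
have E2 : (x + y) * (a + b) = x * a + y * b.
  by rewrite mulrDl !mulrDr xb ya addr0 add0r.
split; rewrite ?E1 ?E2 ?(starD Hs) ?ax ?xa ?By ?yb //.
- by rewrite mulrDl !mulrDr axa byb -!mulrA xb ya !mulr0 addr0 add0r.
- by rewrite mulrDl !mulrDr xax yby -!mulrA ay bx !mulr0 addr0 add0r.
Qed.

(** The exponent is a successor because at exponent 0 the identity would read [1 = 1 + 1]. *)
Lemma exprD_orthogonal a b k :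
  a * b = 0 -> b * a = 0 -> (a + b) ^+ k.+1 = a ^+ k.+1 + b ^+ k.+1.
Proof.
move=> ab ba; elim: k => [|k IHk]; first by rewrite !expr1.
rewrite exprS IHk mulrDl !mulrDr -!exprS.
by rewrite !(exprS _ k) !mulrA ab ba !mul0r addr0 add0r.
Qed.

(** Lets solutions for [a] and [b] at different indices be compared at the larger one. *)
Lemma WD_equations_leq a x j k :
  (j <= k)%N -> WD_equations a j x -> WD_equations a k x.
Proof.
move=> /subnK <- [axa axj xaj]; split=> //.
- by rewrite -addnS exprD -mulrA axj -exprD.
- by rewrite addnC -addSn exprD mulrA xaj -exprD.
Qed.

Lemma WD_equationsD a b x y k : (0 < k)%N ->
  a * b = 0 -> b * a = 0 -> a * y = 0 -> b * x = 0 -> x * b = 0 -> y * a = 0 ->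
  WD_equations a k x -> WD_equations b k y -> WD_equations (a + b) k (x + y).
Proof.
case: k => // k _ ab ba ay bx xb ya [axa axk xak] [byb byk ybk].
split; rewrite ?exprD_orthogonal //.
- rewrite mulrDl (mulrDr a) (mulrDr b) ay bx addr0 add0r mulrDl !mulrDr axa byb.
  by rewrite -!mulrA xb ya !mulr0 addr0 add0r.
- rewrite mulrDl !mulrDr axk byk !(exprSr _ k.+1) -!mulrA ay bx.
  by rewrite !mulr0 addr0 add0r.
- rewrite mulrDl !mulrDr xak ybk !(exprS _ k.+1) !mulrA xb ya.
  by rewrite !mul0r addr0 add0r.
Qed.

(* The projections [a * x] and [x * a] kill [b], so compressing the equations
   of [a + b] by them leaves those of [a], with the same solution [z]. *)
Lemma WD_equations_summand a b x z j : (0 < j)%N -> a * x * a = a ->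
  a * b = 0 -> b * a = 0 -> x * b = 0 -> b * x = 0 ->
  WD_equations (a + b) j z -> WD_equations a j z.
Proof.
case: j => // j _ axa ab ba xb bx [].
rewrite !exprD_orthogonal // => czc czj zcj.
have axc : a * x * (a + b) = a by rewrite mulrDr axa -mulrA xb mulr0 addr0.
have cxa : (a + b) * (x * a) = a by rewrite mulrDl !mulrA axa bx mul0r addr0.
have axX i : a * x * a ^+ i.+1 = a ^+ i.+1 by rewrite exprS mulrA axa.
have axb i : a * x * b ^+ i.+1 = 0.
  by rewrite exprS !mulrA -(mulrA a) xb mulr0 mul0r.
have Xxa i : a ^+ i.+1 * (x * a) = a ^+ i.+1.
  by rewrite exprSr -mulrA (mulrA a) axa.
have bxa i : b ^+ i.+1 * (x * a) = 0.
  by rewrite exprSr -mulrA (mulrA b) bx mul0r mulr0.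
split.
(* With [c = a + b], the two-sided compression turns [c * z * c] into [a * z * a] and [c] into [a].
   In the other two equations [z] occupies one side, so only the opposite side is compressed. *)
- have := congr1 (fun t => a * x * t * (x * a)) czc.
  by rewrite !mulrA axc -(mulrA _ x a) -(mulrA _ (a + b)) cxa axa.
- have := congr1 (fun t => a * x * t) czj.
  by rewrite mulrA !(mulrDr (a * x)) !axX !axb !addr0.
- have := congr1 (fun t => t * (x * a)) zcj.
  by rewrite -mulrA !mulrDl !Xxa !bxa !addr0.
Qed.

End WDMPSum.

Theorem theorem3p10 (R : pzRingType) (star : R -> R)
    (Hstar : proper_involution star)
    (a b aWD bWD adag bdag : R)
    (Ha : WDMP_invertible star a) (Hb : WDMP_invertible star b)
    (HaWD : WD_inverse a aWD) (HbWD : WD_inverse b bWD)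
    (Hadag : MP_inverse star a adag) (Hbdag : MP_inverse star b bdag)
    (Hab : a * b = 0) (Hba : b * a = 0)
    (Hsab : star a * b = 0) (Habs : a * star b = 0)
    (HabWD : a * bWD = 0) (HbWDa : bWD * a = 0)
    (HaWDb : aWD * b = 0) (HbaWD : b * aWD = 0) :
  WDMP_invertible star (a + b) /\
  WDMP_inverse star (a + b) (aWD * a * adag + bWD * b * bdag).
Proof.
have [Hs _] := Hstar.
have [k [kP Hk]] := HaWD; have [l [lP Hl]] := HbWD.
have Hsba : star b * a = 0.
  by rewrite -[a](starK Hs) (ring_involution_mul_eq0 Hs Hsab).
have Hbas : b * star a = 0.
  by rewrite -[b](starK Hs) (ring_involution_mul_eq0 Hs Habs).
have adb := MP_inverse_mul_eq0 Hs Hadag Hsab.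
have bda := MP_inverse_mul_eq0 Hs Hbdag Hsba.
have bad := mul_MP_inverse_eq0 Hs Hadag Hbas.
have abd := mul_MP_inverse_eq0 Hs Hbdag Habs.
have [k0 _ kmin] := kP; have [l0 _ lmin] := lP.
set m := maxn k l.
have m0 : (0 < m)%N by rewrite leq_max k0.
have Hm : WD_equations (a + b) m (aWD + bWD).
  apply: WD_equationsD => //.
  - exact: WD_equations_leq (leq_maxl _ _) Hk.
  - exact: WD_equations_leq (leq_maxr _ _) Hl.
have [ada _ _ _] := Hadag; have [bdb _ _ _] := Hbdag.
have mP : WD_index (a + b) m.
  split=> //; first by exists (aWD + bWD).
  move=> j z j0 Hz; rewrite geq_max; apply/andP; split.
  - exact: kmin j0 (WD_equations_summand j0 ada Hab Hba adb bad Hz).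
  - rewrite addrC in Hz.
    exact: lmin j0 (WD_equations_summand j0 bdb Hba Hab bda abd Hz).
have Hdag := MP_inverseD Hadag Hbdag Hs abd bad adb bda.
have [axa _ _] := Hk; have [byb _ _] := Hl.
set Y := _ + bWD * b * bdag.
have cE : (aWD + bWD) * (a + b) = aWD * a + bWD * b.
  by rewrite mulrDl !mulrDr HaWDb HbWDa addr0 add0r.
have YE : Y * (a + b) = aWD * a + bWD * b.
  (* The Moore-Penrose factors are absorbed, so [Y] and [aWD + bWD] agree once multiplied by [a + b]
     on the right. *)
  rewrite mulrDl !mulrDr -!mulrA adb bda !mulr0 addr0 add0r.
  by rewrite (mulrA a) ada (mulrA b) bdb.
have YP : WDMP_inverse star (a + b) Y.
  exists (aWD + bWD), (adag + bdag), m; split; first by split=> //; exists m.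
  split.
  (* The diagonal terms collapse through [a * aWD * a = a] and its analogue for [b]. *)
  - rewrite YE /Y mulrDl !mulrDr !mulrA -(mulrA aWD a bWD) -(mulrA bWD b aWD).
    rewrite HabWD HbaWD !(mulr0, mul0r) addr0 add0r.
    by rewrite -!(mulrA aWD) -!(mulrA bWD) axa byb.
  - rewrite !mulrDl !mulrDr !mulrA axa byb HabWD HbaWD abd bad.
    by rewrite !mul0r !addr0 !add0r.
  (* Since [m] is positive, one factor [a + b] can be split off next to [Y]. *)
  - by rewrite -(prednK m0) exprS !mulrA YE cE.
by split=> //; split; [exists m, (aWD + bWD) | exists (adag + bdag) | exists Y].
Qed.
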